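(* Consider the system with state $x=(v_{dc},i_{dq},v_{dq})\in\mathbb{R}\times\mathbb{R}^2\times\mathbb{R}^2$, $$C_{dc}\dot v_{dc}=-G_{dc}v_{dc}+i_{dc}-\tfrac{\mu}{2}\mathbf{e}_2^\top i_{dq},$$ $$L\,\dot i_{dq}=-R\,i_{dq}-v_{dc}\,\eta L\boldsymbol{J}\,i_{dq}+\tfrac{\mu}{2}\mathbf{e}_2v_{dc}-v_{dq},$$ $$C\,\dot v_{dq}=-G\,v_{dq}-v_{dc}\,\eta C\boldsymbol{J}\,v_{dq}-i_{l,dq}+i_{dq}.$$ Assume that, for a given constant input $u^*=(i_{dc}^*,i_{l,dq}^* )\in\mathbb{R}\times\mathbb{R}^2$, there exists an equilibrium $x^*=(v_{dc}^*,i_{dq}^*,v_{dq}^* )$ that satisfies $$\frac{C^2\lVert v_{dq}^*\rVert^2}{4G}+\frac{L^2\lVert i_{dq}^*\rVert^2}{4R}<\frac{G_{dc}}{\eta^2}.$$ Then the system, with input $u=(i_{dc},-i_{l,dq})$ and output $y=(v_{dc},v_{dq})$, is strictly passive relative to the pair $(x^*,u^* )$.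
   Context: Here $\boldsymbol{J}=\begin{bmatrix}0&-1\\1&0\end{bmatrix}$, $\mathbf{e}_2=\begin{bmatrix}0\\1\end{bmatrix}$, and $\lVert\cdot\rVert$ is the Euclidean norm. The parameters $C_{dc},G_{dc},L,R,C,G,\eta>0$ and $\mu\in[0,1]$ are constants; $i_{dc}(t)\in\mathbb{R}$ and $i_{l,dq}(t)\in\mathbb{R}^2$ are exogenous inputs. (The system is a three-phase DC/AC converter in a rotating $dq$-frame with angle $\theta$, where $\dot\theta=\eta v_{dc}$.) Strict passivity relative to $(x^*,u^* )$: there exist a differentiable storage function $\mathcal{V}$ of the error $\tilde x=x-x^*$ that is positive definite, and a positive definite function $W$ of $\tilde x$, such that along all trajectories $$\dot{\mathcal V}\le -W(\tilde x)+(i_{dc}-i_{dc}^* )(v_{dc}-v_{dc}^* )-(i_{l,dq}-i_{l,dq}^* )^\top(v_{dq}-v_{dq}^* ).$$ *)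

(* Defs.v *)
(* MathComp / MathComp-Analysis. *)
From HB Require Import structures.
From mathcomp Require Import all_boot all_order all_algebra.
From mathcomp Require Import all_classical all_reals all_analysis.

Set Implicit Arguments.
Unset Strict Implicit.
Unset Printing Implicit Defensive.

Import Order.TTheory GRing.Theory Num.Theory.
Import numFieldNormedType.Exports.

Local Open Scope classical_set_scope.
Local Open Scope ring_scope.

Definition dotv (R : realType) (n : nat) (u v : 'cV[R]_n) : R :=
  (u^T *m v) 0 0.

(* The norm [`|v|] supplied by the library on matrices is the sup norm. *)
Definition enorm (R : realType) (n : nat) (v : 'cV[R]_n) : R :=
  Num.sqrt (dotv v v).

(* J = [0, -1; 1, 0] *)
Definition Jmx (R : realType) : 'M[R]_2 := delta_mx 1 0 - delta_mx 0 1.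

(* indices start at 0, so this is the second unit vector (0, 1)^T *)
Definition e2 (R : realType) : 'cV[R]_2 := delta_mx 1 0.

Record converter (R : realType) := Converter {
  C_dc : R; G_dc : R; L_f : R; R_f : R; C_f : R; G_f : R; eta_c : R; mu_c : R }.

(* x = (v_dc, i_dq, v_dq); a product type, so as to inherit the normed-space
   structure in which derivatives are taken *)
Definition state (R : realType) : normedModType R :=
  (R * 'cV[R]_2 * 'cV[R]_2)%type.

Definition v_dc (R : realType) (x : state R) : R := x.1.1.
Definition i_dq (R : realType) (x : state R) : 'cV[R]_2 := x.1.2.
Definition v_dq (R : realType) (x : state R) : 'cV[R]_2 := x.2.

(* The differential equations, as a relation between the exogenous inputs
   i_dc and i_l = i_{l,dq}, the state x and its velocity dx. *)
Definition dynamics (R : realType) (p : converter R)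
    (i_dc : R) (i_l : 'cV[R]_2) (x dx : state R) : Prop :=
  [/\ C_dc p * v_dc dx
        = - (G_dc p * v_dc x) + i_dc - mu_c p / 2 * dotv (e2 R) (i_dq x),
      L_f p *: i_dq dx
        = - (R_f p *: i_dq x)
          - (v_dc x * eta_c p * L_f p) *: (Jmx R *m i_dq x)
          + (mu_c p / 2 * v_dc x) *: e2 R - v_dq x
    & C_f p *: v_dq dx
        = - (G_f p *: v_dq x)
          - (v_dc x * eta_c p * C_f p) *: (Jmx R *m v_dq x)
          - i_l + i_dq x].

Definition equilibrium (R : realType) (p : converter R)
    (i_dcs : R) (i_ls : 'cV[R]_2) (xs : state R) : Prop :=
  dynamics p i_dcs i_ls xs 0.

(* [I] is the time domain; the values of the functions outside [I] are
   irrelevant. *)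
Definition trajectory (R : realType) (p : converter R) (I : set R)
    (i_dc : R -> R) (i_l : R -> 'cV[R]_2) (x : R -> state R) : Prop :=
  forall t, I t ->
    derivable x t 1 /\ dynamics p (i_dc t) (i_l t) (x t) (derive1 x t).

Definition positive_definite (R : realType) (F : state R -> R) : Prop :=
  F 0 = 0 /\ forall x, x != 0 -> 0 < F x.

(* Strict passivity relative to the pair (xs, (i_dcs, i_ls)); the supply rate is
   the pairing of the errors of the input (i_dc, - i_l) and of the output
   (v_dc, v_dq). *)
Definition strictly_passive (R : realType) (p : converter R)
    (i_dcs : R) (i_ls : 'cV[R]_2) (xs : state R) : Prop :=
  exists (V W : state R -> R),
    [/\ (forall x, differentiable V x),
        positive_definite V,
        positive_definite W &
        forall (I : set R) (i_dc : R -> R) (i_l : R -> 'cV[R]_2)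
          (x : R -> state R),
          open I -> is_interval I -> trajectory p I i_dc i_l x ->
          forall t, I t ->
            derive1 (fun s => V (x s - xs)) t
            <= - W (x t - xs)
               + (i_dc t - i_dcs) * (v_dc (x t) - v_dc xs)
               - dotv (i_l t - i_ls) (v_dq (x t) - v_dq xs)].

(* Main.v *)
Require Import Defs.
From HB Require Import structures.
From mathcomp Require Import all_boot all_order all_algebra.
From mathcomp Require Import all_classical all_reals all_analysis.
From mathcomp Require Import ring lra.

Set Implicit Arguments.
Unset Strict Implicit.
Unset Printing Implicit Defensive.

Import Order.TTheory GRing.Theory Num.Theory.
Import numFieldNormedType.Exports.

Local Open Scope classical_set_scope.
Local Open Scope ring_scope.

(** The storage function is the energy of the error [z := x - xs], that is
    half of C_dc v^2 + L |i|^2 + C |w|^2 with z = (v, i, w).  Subtracting the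
    equilibrium equations from the dynamics and pairing with [z], three
    groups of terms disappear: the coupling through [mu_c] and the exchange
    between [i_dq] and [v_dq] are lossless, and the rotation terms contribute
    only through the equilibrium, because
<<
      v_dc x *: J a - v_dc xs *: J as
        = v_dc x *: J (a - as) + (v_dc x - v_dc xs) *: J as
>>
    and J is skew-symmetric.  What is left is an exact power balance
    ([dynamics_power_balance]): the derivative of the energy is the supply
    rate minus
<<
      W z = G_dc v^2 + R |i|^2 + G |w|^2
            + eta v (L i . J i_dq xs + C w . J v_dq xs).
>>
    The cross terms are absorbed by completing the two squares in [i] and [w].
    As J is an isometry, the price is
    eta^2 v^2 (L^2 |i_dq xs|^2 / 4R + C^2 |v_dq xs|^2 / 4G), and the
    hypothesis on the equilibrium says precisely that this is smaller than
    G_dc v^2 when v <> 0.  When v = 0 there are no cross terms.  Hence W is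
    positive definite ([dissipation_pos]). *)

(** * Plane vectors *)

Lemma sum_I2 (R : realType) (F : 'I_2 -> R) : \sum_i F i = F 0 + F 1.
Proof. by rewrite big_ord_recl big_ord1; congr (_ + F _); exact: val_inj. Qed.

Lemma dotvE (R : realType) (u v : 'cV[R]_2) :
  dotv u v = u 0 0 * v 0 0 + u 1 0 * v 1 0.
Proof. by rewrite /dotv mxE sum_I2 !mxE. Qed.

Lemma dotv_ge0 (R : realType) (u : 'cV[R]_2) : 0 <= dotv u u.
Proof. by rewrite dotvE -!expr2 addr_ge0// sqr_ge0. Qed.

Lemma dotv_eq0 (R : realType) (u : 'cV[R]_2) : dotv u u = 0 -> u = 0.
Proof.
move/eqP; rewrite dotvE -!expr2 paddr_eq0 ?sqr_ge0// !sqrf_eq0.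
case/andP => /eqP u0 /eqP u1; apply/matrixP => i j; rewrite (ord1 j) mxE.
by case: i => [[|[|//]] ?]; [rewrite -u0|rewrite -u1]; congr (u _ _);
  apply: val_inj.
Qed.

Lemma enorm_sqr (R : realType) (u : 'cV[R]_2) : enorm u ^+ 2 = dotv u u.
Proof. by rewrite /enorm sqr_sqrtr// dotv_ge0. Qed.

Lemma Jmx_mulE (R : realType) (u : 'cV[R]_2) :
  Jmx R *m u = \col_i (if i == 0 then - u 1 0 else u 0 0).
Proof.
apply/matrixP => i j; rewrite (ord1 j) {j} !mxE sum_I2 !mxE.
have [->|] := eqVneq i 0; first by rewrite /=; ring.
by case: i => [[|[|//]] ?] _ //=; ring.
Qed.

Lemma dotv_Jmx (R : realType) (u : 'cV[R]_2) :
  dotv (Jmx R *m u) (Jmx R *m u) = dotv u u.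
Proof. by rewrite !dotvE Jmx_mulE !mxE/=; ring. Qed.

(** The sum is r |u + (b / 2r) J a|^2, because J is an isometry. *)
Lemma completed_square_ge0 (R : realType) (r b : R) (u a : 'cV[R]_2) : 0 < r ->
  0 <= r * dotv u u + b * dotv u (Jmx R *m a) + b ^+ 2 * dotv a a / (4 * r).
Proof.
move=> r0; rewrite -(dotv_Jmx a); set Ja := Jmx R *m a.
suff -> : r * dotv u u + b * dotv u Ja + b ^+ 2 * dotv Ja Ja / (4 * r) =
    r * dotv (u + (b / (2 * r)) *: Ja) (u + (b / (2 * r)) *: Ja).
  by rewrite mulr_ge0 ?dotv_ge0// ltW.
by rewrite !dotvE !mxE; field; rewrite gt_eqF.
Qed.

(** * Differentials of quadratic functions *)

Lemma is_diff_linear (R : realType) (V : normedModType R) (f : V -> R)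
  (z : V) : linear f -> continuous f -> is_diff z f f.
Proof.
move=> fl fc.
pose fM := GRing.isLinear.Build _ _ _ _ _ fl.
pose fL : {linear _ -> _} := HB.pack f fM.
have -> : f = fL by [].
by apply: DiffDef; [exact: linear_differentiable|exact: diff_lin].
Qed.

Lemma is_diff_sqr_linear (R : realType) (V : normedModType R) (f : V -> R)
  (z : V) : linear f -> continuous f ->
  is_diff z (fun x => f x * f x) (fun h => 2 * (f z * f h)).
Proof.
move=> fl fc; have df := is_diff_linear z fl fc.
apply: is_diff_eq; apply/funext => h /=.
by rewrite -[LHS]/(f z * f h + f z * f h); ring.
Qed.

Lemma is_diff_dotv_linear (R : realType) (V : normedModType R)
  (f : V -> 'cV[R]_2) (z : V) : linear f -> continuous f ->
  is_diff z (fun x => dotv (f x) (f x)) (fun h => 2 * dotv (f z) (f h)).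
Proof.
move=> fl fc.
have coord k : is_diff z (fun x => f x k 0 * f x k 0)
                         (fun h => 2 * (f z k 0 * f h k 0)).
  apply: is_diff_sqr_linear => [a x y|x]; first by rewrite fl !mxE.
  exact: (@continuous_comp _ _ _ f (fun M : 'cV[R]_2 => M k 0) x (fc x)
            (@coord_continuous _ _ _ _ _ _)).
have -> : (fun x => dotv (f x) (f x)) =
    (fun x => f x 0 0 * f x 0 0) + (fun x => f x 1 0 * f x 1 0).
  by apply/funext => x; rewrite dotvE.
by apply: is_diff_eq; apply/funext => h /=; rewrite dotvE mulrDr.
Qed.

(** * Diagonal quadratic forms on the state space *)

Definition dform (R : realType) (a b c : R) (z h : state R) : R :=
  a * (v_dc z * v_dc h) + b * dotv (i_dq z) (i_dq h)
  + c * dotv (v_dq z) (v_dq h).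

Lemma dform_pos (R : realType) (a b c : R) : 0 < a -> 0 < b -> 0 < c ->
  positive_definite (fun z => dform a b c z z).
Proof.
move=> a0 b0 c0; split=> [|z z0].
  rewrite /dform -[v_dc 0]/(0 : R) -[i_dq 0]/(0 : 'cV[R]_2).
  by rewrite -[v_dq 0]/(0 : 'cV[R]_2) !dotvE !mxE; ring.
have zE : z = (v_dc z, i_dq z, v_dq z) by case: z {z0} => [[]].
have v0 : 0 <= a * (v_dc z * v_dc z).
  by rewrite -expr2 mulr_ge0 ?sqr_ge0// ltW.
have i0 : 0 <= b * dotv (i_dq z) (i_dq z) by rewrite mulr_ge0 ?dotv_ge0// ltW.
have w0 : 0 <= c * dotv (v_dq z) (v_dq z) by rewrite mulr_ge0 ?dotv_ge0// ltW.
rewrite lt_neqAle !addr_ge0// andbT eq_sym !paddr_eq0 ?addr_ge0//.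
apply: contra z0; rewrite !mulf_eq0 (gt_eqF a0) (gt_eqF b0) (gt_eqF c0) /= orbb.
case/andP => /andP[/eqP v_eq0 /eqP/dotv_eq0 i_eq0] /eqP/dotv_eq0 w_eq0.
by rewrite zE v_eq0 i_eq0 w_eq0.
Qed.

Lemma is_diff_dform (R : realType) (a b c : R) (z : state R) :
  is_diff z (fun x => dform a b c x x) (fun h => 2 * dform a b c z h).
Proof.
have d1 : is_diff z (fun x => v_dc x * v_dc x)
                    (fun h => 2 * (v_dc z * v_dc h)).
  apply: is_diff_sqr_linear => [k x y //|x].
  exact: (@continuous_comp _ _ _ fst fst x cvg_fst cvg_fst).
have d2 : is_diff z (fun x => dotv (i_dq x) (i_dq x))
                    (fun h => 2 * dotv (i_dq z) (i_dq h)).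
  apply: is_diff_dotv_linear => [k x y //|x].
  exact: (@continuous_comp _ _ _ fst snd x cvg_fst cvg_snd).
have d3 : is_diff z (fun x => dotv (v_dq x) (v_dq x))
                    (fun h => 2 * dotv (v_dq z) (v_dq h)).
  by apply: is_diff_dotv_linear => [k x y //|x]; exact: cvg_snd.
have D := is_diffD (is_diffD (is_diffZ a d1) (is_diffZ b d2)) (is_diffZ c d3).
apply: (is_diff_eq D); apply/funext => h.
rewrite -[LHS]/(a * (2 * (v_dc z * v_dc h))
  + b * (2 * dotv (i_dq z) (i_dq h)) + c * (2 * dotv (v_dq z) (v_dq h))).
by rewrite /dform; ring.
Qed.

(** * Energy and dissipation of the error *)

Definition energy (R : realType) (p : converter R) (z : state R) : R :=
  dform (C_dc p / 2) (L_f p / 2) (C_f p / 2) z z.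

Lemma is_diff_energy (R : realType) (p : converter R) (z : state R) :
  is_diff z (energy p) (dform (C_dc p) (L_f p) (C_f p) z).
Proof.
apply: (is_diff_eq (is_diff_dform _ _ _ z)); apply/funext => h.
by rewrite /dform; lra.
Qed.

Lemma energy_pos (R : realType) (p : converter R) :
  0 < C_dc p -> 0 < L_f p -> 0 < C_f p -> positive_definite (energy p).
Proof. by move=> Cdc0 L0 C0; apply: dform_pos; rewrite divr_gt0. Qed.

Lemma derive1_energy (R : realType) (p : converter R) (xs : state R)
  (x : R -> state R) (t : R) : derivable x t 1 ->
  derive1 (fun s => energy p (x s - xs)) t =
  dform (C_dc p) (L_f p) (C_f p) (x t - xs) (derive1 x t).
Proof.
move=> /derivable1_diffP dx.
have dxB := is_diffB (differentiableP dx) (is_diff_cst xs t).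
have D : is_diff t (fun s => energy p (x s - xs))
    (fun h => dform (C_dc p) (L_f p) (C_f p) (x t - xs) ('d x t h)).
  apply: (is_diff_eq (is_diff_comp dxB (is_diff_energy p (x t - xs)))).
  apply/funext => h /=; congr (dform _ _ _ _ _).
  by rewrite -[LHS]/('d x t h - 0) subr0.
have [dE valE] := D.
by rewrite derive1E'// (derive1E' dx) valE.
Qed.

Definition dissipation (R : realType) (p : converter R) (xs z : state R) : R :=
  dform (G_dc p) (R_f p) (G_f p) z z
  + eta_c p * v_dc z * (L_f p * dotv (i_dq z) (Jmx R *m i_dq xs)
                        + C_f p * dotv (v_dq z) (Jmx R *m v_dq xs)).

Lemma dissipation_pos (R : realType) (p : converter R) (xs : state R) :
  0 < G_dc p -> 0 < R_f p -> 0 < G_f p -> 0 < eta_c p ->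
  C_f p ^+ 2 * enorm (v_dq xs) ^+ 2 / (4 * G_f p)
    + L_f p ^+ 2 * enorm (i_dq xs) ^+ 2 / (4 * R_f p) < G_dc p / eta_c p ^+ 2 ->
  positive_definite (dissipation p xs).
Proof.
move=> Gdc0 R0 G0 eta0; rewrite !enorm_sqr ltr_pdivlMr ?exprn_gt0// => cond.
have [dform0 dform_gt0] := dform_pos Gdc0 R0 G0.
split=> [|z z0]; rewrite /dissipation.
  by rewrite dform0 -[v_dc 0]/(0 : R) mulr0 mul0r addr0.
have [v0|v0] := eqVneq (v_dc z) 0.
  by rewrite v0 mulr0 mul0r addr0 dform_gt0.
have := completed_square_ge0
  (v_dc z * eta_c p * L_f p) (i_dq z) (i_dq xs) R0.
have := completed_square_ge0
  (v_dc z * eta_c p * C_f p) (v_dq z) (v_dq xs) G0.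
have vpos : 0 < v_dc z ^+ 2 by rewrite exprn_even_gt0.
move: cond; rewrite -subr_gt0 => /(mulr_gt0 vpos).
(* This inequality and the two completed squares add up to the goal. *)
by rewrite /dform; lra.
Qed.

(** Only the part of the rotation terms that is proportional to the error of
    [v_dc] does work: the rest is orthogonal to the error, because J is
    skew-symmetric.  The error form of the dynamics is obtained by subtracting
    the equilibrium equations, the relation being affine in everything but
    these rotation terms. *)
Lemma dynamics_power_balance (R : realType) (p : converter R)
  (i_dcs : R) (i_ls : 'cV[R]_2) (xs : state R) (i_dc : R) (i_l : 'cV[R]_2)
  (x dx : state R) :
  equilibrium p i_dcs i_ls xs -> dynamics p i_dc i_l x dx ->
  dform (C_dc p) (L_f p) (C_f p) (x - xs) dx
  = - dissipation p xs (x - xs) + (i_dc - i_dcs) * (v_dc x - v_dc xs)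
    - dotv (i_l - i_ls) (v_dq x - v_dq xs).
Proof.
move=> [dc0 i0 v0] [dc1 i1 v1].
have dcE := congr2 (fun a b => a - b) dc1 dc0.
have iE k := congr2 (fun a b : 'cV[R]_2 => (a - b) k 0) i1 i0.
have vE k := congr2 (fun a b : 'cV[R]_2 => (a - b) k 0) v1 v0.
move: dcE (iE 0) (iE 1) (vE 0) (vE 1) => {dc0 i0 v0 dc1 i1 v1 iE vE}.
rewrite /dissipation /dform.
rewrite -[v_dc 0]/(0 : R) -[i_dq 0]/(0 : 'cV[R]_2) -[v_dq 0]/(0 : 'cV[R]_2).
rewrite -[v_dc (x - xs)]/(v_dc x - v_dc xs).
rewrite -[i_dq (x - xs)]/(i_dq x - i_dq xs).
rewrite -[v_dq (x - xs)]/(v_dq x - v_dq xs).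
rewrite !Jmx_mulE !scaler0 mulr0 !subr0 !dotvE !mxE /=.
move=> dcE iE0 iE1 vE0 vE1.
(* Each velocity is brought next to its own coefficient C_dc, L or C. *)
rewrite mulrCA !mulrDr ![L_f p * (_ * _)]mulrCA ![C_f p * (_ * _)]mulrCA.
by rewrite dcE iE0 iE1 vE0 vE1; ring.
Qed.

Theorem theorem3 (R : realType) (p : converter R)
  (hCdc : 0 < C_dc p) (hGdc : 0 < G_dc p) (hL : 0 < L_f p) (hR : 0 < R_f p)
  (hC : 0 < C_f p) (hG : 0 < G_f p) (heta : 0 < eta_c p)
  (hmu : 0 <= mu_c p <= 1)
  (i_dcs : R) (i_ls : 'cV[R]_2) (xs : state R)
  (heq : equilibrium p i_dcs i_ls xs)
  (hcond : C_f p ^+ 2 * enorm (v_dq xs) ^+ 2 / (4 * G_f p)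
           + L_f p ^+ 2 * enorm (i_dq xs) ^+ 2 / (4 * R_f p)
           < G_dc p / eta_c p ^+ 2) :
  strictly_passive p i_dcs i_ls xs.
Proof.
exists (energy p), (dissipation p xs); split.
- by move=> z; have [] := is_diff_energy p z.
- exact: energy_pos.
- exact: dissipation_pos.
- move=> I i_dc i_l x _ _ traj t /traj[dx dyn].
  by rewrite derive1_energy// (dynamics_power_balance heq dyn).
Qed.
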